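(* Let $\Omega\subset\mathbb{R}^2$ be a bounded domain with $C^3$ boundary, $\mathbf{u}\in C^1$, and assume M-convergence $\delta=Mh$ with $M>0$ fixed. For $\mathbf{x}\in\mathcal{I}\Omega_N$ let $\hat{\mathbf{n}},\hat{\mathbf{p}}$ be perturbed orthonormal vectors with $|\hat{\mathbf{n}}-\mathbf{n}|=O(h)$, $|\hat{\mathbf{p}}-\mathbf{p}|=O(h)$, and let $\hat{\mathbf{T}}$ be a perturbed traction whose components satisfy $$\hat T_p(\overline{\mathbf{x}})=\mu\Big(\frac{\partial u_p}{\partial\mathbf{n}}(\mathbf{x})+\frac{\partial u_n}{\partial\mathbf{p}}(\mathbf{x})\Big)+O(h),\qquad \hat T_n(\overline{\mathbf{x}})=\lambda\nabla\cdot\mathbf{u}(\mathbf{x})+2\mu\frac{\partial u_n}{\partial\mathbf{n}}(\mathbf{x})+O(h),$$ where $u_p,u_n$ are the components of $\mathbf{u}$ along the unperturbed $\mathbf{p},\mathbf{n}$. Let $\hat{\mathcal{L}}_{N\delta}$ and $\hat{\mathbf{f}}_{N\delta}$ be $\mathcal{L}_{N\delta}$ and $\mathbf{f}_{N\delta}$ with $\mathbf{n},\mathbf{p},T_p,T_n$ replaced by $\hat{\mathbf{n}},\hat{\mathbf{p}},\hat T_p,\hat T_n$ (the dilatation $\theta$ is unchanged). Then for $\mathbf{x}\in\mathcal{I}\Omega_N$, $$\big|\hat{\mathcal{L}}_{N\delta}\mathbf{u}(\mathbf{x})-\hat{\mathbf{f}}_{N\delta}(\mathbf{x})-\mathcal{L}_{N\delta}\mathbf{u}(\mathbf{x})+\mathbf{f}_{N\delta}(\mathbf{x})\big|=O(1),$$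 with constant independent of $h$, $\delta$ and $\mathbf{x}$; here $\mathbf{f}_{N\delta}$ uses the unperturbed traction $T_p=\mu(\partial_{\mathbf{n}}u_p+\partial_{\mathbf{p}}u_n)$, $T_n=\lambda\nabla\cdot\mathbf{u}+2\mu\partial_{\mathbf{n}}u_n$.
   Context: Dimension $d=2$; $C_\alpha=2$, $C_\beta=16$; Lamé constants $\lambda,\mu>0$. Kernel $K(r)=1/r$ for $0<r\le\delta$, $0$ otherwise; $m(\delta)=\int_{B_\delta(\mathbf{x})}K|\mathbf{y}-\mathbf{x}|^2d\mathbf{y}$. $\mathcal{I}\Omega_N=\{\mathbf{x}\in\Omega:\operatorname{dist}(\mathbf{x},\partial\Omega_N)<\delta\}$ with $\partial\Omega_N\subset\partial\Omega$ the traction boundary; $\overline{\mathbf{x}}$ the nearest point on $\partial\Omega_N$, $\mathbf{n},\mathbf{p}$ the outward unit normal and unit tangent there. Dilatation on $\mathcal{I}\Omega_N$: $\theta(\mathbf{x})=\frac{d}{m(\delta)}\int_{B_\delta(\mathbf{x})\cap\Omega}K(\mathbf{y}-\mathbf{x})\cdot\mathbf{M}(\mathbf{x})(\mathbf{u}(\mathbf{y})-\mathbf{u}(\mathbf{x}))d\mathbf{y}$, $\mathbf{M}(\mathbf{x})=[\frac{d}{m(\delta)}\int_{B_\delta(\mathbf{x})\cap\Omega}K(\mathbf{y}-\mathbf{x})\otimes(\mathbf{y}-\mathbf{x})d\mathbf{y}]^{-1}$ (and uncorrected $\theta(\mathbf{y})=\frac{d}{m(\delta)}\int_{B_\delta(\mathbf{y})}K(\mathbf{w}-\mathbf{y})\cdot(\mathbf{u}(\mathbf{w})-\mathbf{u}(\mathbf{y}))d\mathbf{w}$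 away from $\mathcal{I}\Omega_N$). With $\mathbf{z}=\mathbf{y}-\mathbf{x}$: $\mathcal{L}_{N\delta}\mathbf{u}(\mathbf{x})=-\frac{C_\alpha}{m(\delta)}\int_{B_\delta(\mathbf{x})\cap\Omega}(\lambda-\mu)K\mathbf{z}(\theta(\mathbf{x})+\theta(\mathbf{y}))d\mathbf{y}-\frac{C_\beta}{m(\delta)}\int_{B_\delta(\mathbf{x})\cap\Omega}\mu K\frac{\mathbf{z}\otimes\mathbf{z}}{|\mathbf{z}|^2}(\mathbf{u}(\mathbf{y})-\mathbf{u}(\mathbf{x}))d\mathbf{y}-\frac{2C_\alpha\theta(\mathbf{x})}{m(\delta)}\int_{B_\delta(\mathbf{x})\setminus\Omega}(\lambda-\mu)K\mathbf{z}d\mathbf{y}-\frac{C_\beta\theta(\mathbf{x})}{2m(\delta)}\int_{B_\delta(\mathbf{x})\setminus\Omega}(\lambda+2\mu)K\frac{(\mathbf{z}\cdot\mathbf{n})(\mathbf{z}\cdot\mathbf{p})^2}{|\mathbf{z}|^2}\mathbf{n}d\mathbf{y}+\frac{C_\beta\theta(\mathbf{x})}{2m(\delta)}\int_{B_\delta(\mathbf{x})\setminus\Omega}\lambda K\frac{(\mathbf{z}\cdot\mathbf{n})^3}{|\mathbf{z}|^2}\mathbf{n}d\mathbf{y}$; $\mathbf{f}_{N\delta}(\mathbf{x})=\mathbf{f}(\mathbf{x})+\frac{C_\beta}{m(\delta)}\int_{B_\delta(\mathbf{x})\setminus\Omega}K\frac{(\mathbf{z}\cdot\mathbf{n})(\mathbf{z}\cdot\mathbf{p})^2}{|\mathbf{z}|^2}T_p\mathbf{p}d\mathbf{y}+\frac{C_\beta}{2m(\delta)}\int_{B_\delta(\mathbf{x})\setminus\Omega}K\frac{(\mathbf{z}\cdot\mathbf{n})((\mathbf{z}\cdot\mathbf{n})^2-(\mathbf{z}\cdot\mathbf{p})^2)}{|\mathbf{z}|^2}T_n\mathbf{n}d\mathbf{y}$.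 $h$ is the discretization fill distance. *)

(* Defs.v *)
From mathcomp Require Import all_boot all_order all_algebra.
From mathcomp Require Import all_classical all_reals all_analysis.
Import Order.TTheory GRing.Theory Num.Theory numFieldNormedType.Exports.
Local Open Scope classical_set_scope.
Local Open Scope ring_scope.
Set Implicit Arguments.
Unset Strict Implicit.
Unset Printing Implicit Defensive.

Section Peridynamics.
Variable R : realType.

Definition pt := (R * R)%type.

Definition dot (a b : pt) : R := a.1 * b.1 + a.2 * b.2.
Definition enorm (a : pt) : R := Num.sqrt (dot a a).
Definition vadd (a b : pt) : pt := (a.1 + b.1, a.2 + b.2).
Definition vsub (a b : pt) : pt := (a.1 - b.1, a.2 - b.2).
Definition smul (c : R) (a : pt) : pt := (c * a.1, c * a.2).
Definition orthonormal2 (e1 e2 : pt) : Prop :=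
  dot e1 e1 = 1 /\ dot e2 e2 = 1 /\ dot e1 e2 = 0.

Definition leb2 := ((@lebesgue_measure R) \x (@lebesgue_measure R))%E.
Definition sint (A : set pt) (F : pt -> R) : R := Rintegral leb2 A F.
Definition vint (A : set pt) (F : pt -> pt) : pt :=
  (sint A (fun y => (F y).1), sint A (fun y => (F y).2)).

Definition eball (x : pt) (delta : R) : set pt :=
  [set y | enorm (vsub y x) < delta].

Definition is_domain (O : set pt) : Prop := open O /\ connected O /\ O !=set0.
Definition bdry (O : set pt) : set pt := closure O `\` O.

Definition C3fun (g : R -> R) : Prop :=
  (forall k : nat, (k < 3)%N -> forall s : R, derivable (derive1n k g) s 1)
  /\ continuous (derive1n 3 g).

Definition is_chart (O : set pt) (b : pt) (r : R) (e1 e2 : pt) (g : R -> R) :=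
  0 < r /\ orthonormal2 e1 e2 /\
  forall y, enorm (vsub y b) < r ->
    (O y <-> dot (vsub y b) e2 < g (dot (vsub y b) e1)).

Definition C3_boundary (O : set pt) : Prop :=
  forall b, bdry O b -> exists r e1 e2 g, C3fun g /\ is_chart O b r e1 e2 g.

Definition outward_unit_normal (O : set pt) (b v : pt) : Prop :=
  exists r e1 e2 (g : R -> R), (forall s, derivable g s 1) /\
    is_chart O b r e1 e2 g /\
    v = smul (Num.sqrt (1 + (derive1 g 0) ^+ 2))^-1 (vsub e2 (smul (derive1 g 0) e1)).

Definition C1field (u : pt -> pt) : Prop :=
  (forall x : pt, differentiable u x) /\ (forall v : pt, continuous ('D_v u)).

Definition dcomp (u : pt -> pt) (w v x : pt) : R := dot ('D_v u x) w.
Definition divergence (u : pt -> pt) (x : pt) : R :=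
  ('D_((1 : R), (0 : R)) u x).1 + ('D_((0 : R), (1 : R)) u x).2.

Definition dim2 : R := 2.
Definition Calpha : R := 2.
Definition Cbeta : R := 16.
Definition kern (delta r : R) : R := if (0 < r) && (r <= delta) then r^-1 else 0.
Definition mdelta (delta : R) : R :=
  sint (eball (0, 0) delta) (fun z => kern delta (enorm z) * enorm z ^+ 2).

Definition intN (O GN : set pt) (delta : R) : set pt :=
  [set x | O x /\ exists b, GN b /\ enorm (vsub x b) < delta].

(* corrected dilatation on I Omega_N :
   theta(x) = d/m int_{B cap O} K(|z|) z . M(x) (u(y)-u(x)),
   M(x) = [ d/m int_{B cap O} K(|z|) z (x) z ]^{-1} (2x2 inverse written out) *)
Definition theta_corr (O : set pt) (u : pt -> pt) (delta : R) (x : pt) : R :=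
  let m := mdelta delta in
  let A := eball x delta `&` O in
  let G (i j : bool) := dim2 / m *
     sint A (fun y => let z := vsub y x in
       kern delta (enorm z) * (if i then z.1 else z.2) * (if j then z.1 else z.2)) in
  let a := G true true in let b := G true false in
  let c := G false true in let d := G false false in
  let det := a * d - b * c in
  let Minv (w : pt) : pt := ((d * w.1 - b * w.2) / det, (a * w.2 - c * w.1) / det) in
  dim2 / m * sint A (fun y => let z := vsub y x in
                     kern delta (enorm z) * dot z (Minv (vsub (u y) (u x)))).

Definition theta_unc (u : pt -> pt) (delta : R) (y : pt) : R :=
  dim2 / mdelta delta * sint (eball y delta) (fun w => let z := vsub w y in
                     kern delta (enorm z) * dot z (vsub (u w) (u y))).

Definition theta (O GN : set pt) (u : pt -> pt) (delta : R) (y : pt) : R :=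
  if `[< intN O GN delta y >] then theta_corr O u delta y else theta_unc u delta y.

Definition LNd (O GN : set pt) (u : pt -> pt) (lam mu delta : R) (nv pv x : pt) : pt :=
  let m := mdelta delta in
  let A := eball x delta `&` O in
  let Ac := eball x delta `\` O in
  let th := theta O GN u delta x in
  let K y := kern delta (enorm (vsub y x)) in
  let zz y := vsub y x in
  vadd (smul (- (Calpha / m)) (vint A (fun y =>
          smul ((lam - mu) * K y * (th + theta O GN u delta y)) (zz y))))
  (vadd (smul (- (Cbeta / m)) (vint A (fun y =>
          smul (mu * K y / enorm (zz y) ^+ 2 * dot (zz y) (vsub (u y) (u x))) (zz y))))
  (vadd (smul (- (2 * Calpha * th / m)) (vint Ac (fun y =>
          smul ((lam - mu) * K y) (zz y))))
  (vadd (smul (- (Cbeta * th / (2 * m))) (vint Ac (fun y =>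
          smul ((lam + 2 * mu) * K y * (dot (zz y) nv * dot (zz y) pv ^+ 2)
                / enorm (zz y) ^+ 2) nv)))
        (smul (Cbeta * th / (2 * m)) (vint Ac (fun y =>
          smul (lam * K y * dot (zz y) nv ^+ 3 / enorm (zz y) ^+ 2) nv)))))).

Definition fNd (O : set pt) (f : pt -> pt) (delta : R) (nv pv : pt) (Tp Tn : R)
    (x : pt) : pt :=
  let m := mdelta delta in
  let Ac := eball x delta `\` O in
  let K y := kern delta (enorm (vsub y x)) in
  let zz y := vsub y x in
  vadd (f x)
  (vadd (smul (Cbeta / m) (vint Ac (fun y =>
          smul (K y * (dot (zz y) nv * dot (zz y) pv ^+ 2) / enorm (zz y) ^+ 2 * Tp) pv)))
        (smul (Cbeta / (2 * m)) (vint Ac (fun y =>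
          smul (K y * (dot (zz y) nv * (dot (zz y) nv ^+ 2 - dot (zz y) pv ^+ 2))
                / enorm (zz y) ^+ 2 * Tn) nv)))).

Definition tracP (u : pt -> pt) (mu : R) (nv pv x : pt) : R :=
  mu * (dcomp u pv nv x + dcomp u nv pv x).
Definition tracN (u : pt -> pt) (lam mu : R) (nv x : pt) : R :=
  lam * divergence u x + 2 * mu * dcomp u nv nv x.

End Peridynamics.

(* Main.v *)
(** The terms of L_N that do not involve n and p cancel in the difference, as
    does f.  What remains is 1/m(delta) times a combination of two cubic moments,
    the integrals over B_delta(x) \ Omega of K (z.n)(z.p)^2/|z|^2 and
    K (z.n)^3/|z|^2, with coefficients polynomial in theta(x), the tractions and the
    components of n and p.  Since K(r) r <= 1, these integrands
    are bounded by 1 and move by O(h) under the perturbation, so the moments move by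
    O(h delta^2); as m(delta) >= delta^3/64 and delta = M h, the difference is O(1)
    once theta is bounded.

    For the latter one needs det M(x)^-1 bounded below, uniformly in x near the
    boundary.  A chart is Lipschitz, so B_delta(x) and Omega contain a common square
    of side proportional to delta, uniformly by compactness of the boundary; and for
    every vector k, some corner subsquare satisfies |k.z| >= c delta |k|, which
    bounds the quadratic form of M(x)^-1 from below. *)
Require Import Defs.
From mathcomp Require Import all_boot all_order all_algebra.
From mathcomp Require Import all_classical all_reals all_analysis.
From mathcomp Require Import measurable_realfun ring lra.
Import Order.TTheory GRing.Theory Num.Theory numFieldNormedType.Exports.
Local Open Scope classical_set_scope.
Local Open Scope ring_scope.
Set Implicit Arguments.
Unset Strict Implicit.
Unset Printing Implicit Defensive.

(** * Measurability *)

Section Measurability.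
Variable R : realType.
Implicit Types (A : set (R * R)) (f g : R * R -> R).

(** Second countability of the plane: [A] is the union of the boxes with rational centre and radius
    that it contains, and these are countably many. *)
Lemma open_measurable_prod A : open A -> measurable A.
Proof.
move=> oA.
pose rect (q : rat * rat * rat) : set (R * R) :=
  ball (ratr q.1.1 : R) (ratr q.2) `*` ball (ratr q.1.2 : R) (ratr q.2).
have -> : A = \bigcup_q (if `[< rect q `<=` A >] then rect q else set0).
  apply/seteqP; split => [[x y] Axy|z [q _]]; last first.
    by case: asboolP => // qA; exact: qA.
  have /nbhs_ballP[e /= e0 eA] : nbhs (x, y) A by exact: open_nbhs_nbhs.
  (* A radius below [e / 2] and a centre closer to [(x, y)] than that radius make the box contain
     [(x, y)] and stay within [e] of it. *)
  have [r /[!in_itv]/= /andP[r0 re]] := @rat_in_itvoo R 0 (e / 2) ltac:(lra).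
  have [p /[!in_itv]/= /andP[p0 pe]] := @rat_in_itvoo R x (x + ratr r) ltac:(lra).
  have [q /[!in_itv]/= /andP[q0 qe]] := @rat_in_itvoo R y (y + ratr r) ltac:(lra).
  exists (p, q, r) => //; case: asboolP => [_|nA].
    by split => /=; rewrite /ball/= ltr_norml; apply/andP; split; lra.
  exfalso; apply: nA => -[a b] [/=]; rewrite /ball/= !ltr_norml => /andP[a1 a2] /andP[b1 b2].
  by apply: eA; split; rewrite /ball/= ltr_norml; apply/andP; split; lra.
apply: countable_bigcupT_measurable; first exact: countableP.
move=> q; case: ifP => _; last exact: measurable0.
by apply: measurableX; exact: measurable_ball.
Qed.

Lemma continuous_measurable_prod f : continuous f -> measurable_fun setT f.
Proof.
move=> cf; apply: (measurability _ (RGenOpens.measurableE R)).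
move=> _ [_ [a [b ->]] <-]; rewrite setTI; apply: open_measurable_prod.
by move/continuousP : cf; apply; exact: interval_open.
Qed.

(** Inversion is discontinuous at 0, but on nonnegative values it is the real power of exponent -1,
    which is measurable. *)
Lemma measurable_invr_ge0 f : (forall y, 0 <= f y) ->
  measurable_fun setT f -> measurable_fun setT (fun y => (f y)^-1).
Proof.
move=> f0 mf.
under eq_fun do rewrite -powR_inv1//.
by apply: (measurableT_comp (measurable_powR _)).
Qed.

Lemma measurable_dot (a b : R * R -> pt R) :
  measurable_fun setT a -> measurable_fun setT b ->
  measurable_fun setT (fun y => dot (a y) (b y)).
Proof.
move=> ma mb; apply: measurable_funD; apply: measurable_funM.
- exact: (measurableT_comp measurable_fst).
- exact: (measurableT_comp measurable_fst).
- exact: (measurableT_comp measurable_snd).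
- exact: (measurableT_comp measurable_snd).
Qed.

Lemma measurable_vsub (x : pt R) : measurable_fun setT (fun y : R * R => vsub y x).
Proof.
by apply/measurable_fun_pairP; split; apply: measurable_funB.
Qed.

Lemma measurable_enorm (x : pt R) :
  measurable_fun setT (fun y : R * R => enorm (vsub y x)).
Proof.
have ms : measurable_fun setT (@Num.sqrt R).
  by apply: continuous_measurable_fun; exact: sqrt_continuous.
apply: (measurableT_comp ms); apply: measurable_dot; exact: measurable_vsub.
Qed.

Lemma measurable_kern d (x : pt R) :
  measurable_fun setT (fun y : R * R => kern d (enorm (vsub y x))).
Proof.
apply: measurable_fun_ifT => //.
  apply: measurable_and.
    by apply: measurable_fun_ltr => //; exact: measurable_enorm.
  by apply: measurable_fun_ler => //; exact: measurable_enorm.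
by apply: measurable_invr_ge0; [move=> y; exact: sqrtr_ge0|exact: measurable_enorm].
Qed.

Lemma measurable_eball d (x : pt R) : measurable (eball x d : set (R * R)).
Proof.
rewrite (_ : eball x d = [set: R * R] `&` (fun y => enorm (vsub y x)) @^-1` `]-oo, d[%classic).
  by apply: measurable_enorm.
by apply/seteqP; split => y /=; rewrite in_itv//= => -[].
Qed.

End Measurability.

(** * Integrals over the plane *)

Section EuclideanPlane.
Variable R : realType.
Implicit Types a b c : pt R.

Lemma enorm_ge0 a : 0 <= enorm a. Proof. exact: sqrtr_ge0. Qed.

Lemma sqr_enorm a : enorm a ^+ 2 = dot a a.
Proof. by rewrite sqr_sqrtr// /dot addr_ge0// -expr2 sqr_ge0. Qed.

(** Cauchy-Schwarz, from Lagrange's identity: the defect of the squares is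
    [(a.1 * b.2 - a.2 * b.1) ^+ 2]. *)
Lemma dot_le_enorm a b : `|dot a b| <= enorm a * enorm b.
Proof.
rewrite -(@ler_pXn2r _ 2)// ?nnegrE ?mulr_ge0 ?enorm_ge0//.
rewrite exprMn !sqr_enorm real_normK ?num_real// /dot.
have := sqr_ge0 (a.1 * b.2 - a.2 * b.1); nra.
Qed.

Lemma fst_le_enorm a : `|a.1| <= enorm a.
Proof.
rewrite -(@ler_pXn2r _ 2)// ?nnegrE ?enorm_ge0// sqr_enorm real_normK ?num_real//.
by rewrite /dot -!expr2 lerDl sqr_ge0.
Qed.

Lemma snd_le_enorm a : `|a.2| <= enorm a.
Proof.
rewrite -(@ler_pXn2r _ 2)// ?nnegrE ?enorm_ge0// sqr_enorm real_normK ?num_real//.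
by rewrite /dot -!expr2 lerDr sqr_ge0.
Qed.

Lemma enorm_le_l1 a : enorm a <= `|a.1| + `|a.2|.
Proof.
rewrite -(@ler_pXn2r _ 2)// ?nnegrE ?enorm_ge0// ?addr_ge0//.
rewrite sqr_enorm sqrrD !real_normK ?num_real// /dot -!expr2.
have : 0 <= `|a.1| * `|a.2| by rewrite mulr_ge0.
lra.
Qed.

Lemma enormD a b : enorm (vadd a b) <= enorm a + enorm b.
Proof.
rewrite -(@ler_pXn2r _ 2)// ?nnegrE ?enorm_ge0// ?addr_ge0 ?enorm_ge0//.
rewrite sqrrD !sqr_enorm; have := dot_le_enorm a b; rewrite ler_norml /dot /vadd/=.
by move=> /andP[_]; nra.
Qed.

Lemma enorm_smul (k : R) a : enorm (smul k a) = `|k| * enorm a.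
Proof.
rewrite /enorm -[`|k|]sqrtr_sqr -sqrtrM ?sqr_ge0//; congr Num.sqrt.
by rewrite /dot/=; ring.
Qed.

Lemma enorm_smul_unit (k : R) a : dot a a = 1 -> enorm (smul k a) = `|k|.
Proof. by move=> a1; rewrite enorm_smul /enorm a1 sqrtr1 mulr1. Qed.

End EuclideanPlane.

(* The product on which [leb2] lives; its measurable structure has another display
   than the default one of [R * R], to which it is convertible. *)
Notation plane R := (measurableTypeR R * measurableTypeR R)%type.

Section PlaneIntegrals.
Variable R : realType.
Implicit Types (A : set (pt R)) (f g : pt R -> R) (q x : pt R) (s d B C : R).

(** Squares replace balls wherever an area is computed, since the product measure gives their area
    directly. *)
Definition square q (s : R) : set (pt R) :=
  `[q.1 - s, q.1 + s]%classic `*` `[q.2 - s, q.2 + s]%classic.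

Lemma measurable_square q s : measurable (square q s : set (plane R)).
Proof. by apply: measurableX; exact: measurable_itv. Qed.

Lemma leb2_square q s : 0 <= s -> leb2 (square q s) = (4 * s ^+ 2)%:E.
Proof.
move=> s0; rewrite /leb2 product_measure1E; try exact: measurable_itv.
rewrite /= !lebesgue_measure_itv /= !lte_fin.
(* The length of an interval is defined by cases on its endpoints, so the degenerate square is
   treated apart. *)
have [s1|s1] := ltrP 0 s.
  have lt1 (t : R) : t - s < t + s by lra.
  by rewrite !lt1 -!EFinB -EFinM; congr EFin; ring.
have -> : s = 0 by apply/eqP; rewrite eq_le s0 s1.
by rewrite !subr0 !addr0 !ltxx mule0 expr0n/= mulr0.
Qed.

Lemma squareP q s y : square q s y <-> `|y.1 - q.1| <= s /\ `|y.2 - q.2| <= s.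
Proof.
rewrite /square /= !in_itv/= !ler_norml; split.
  by move=> [/andP[? ?] /andP[? ?]]; split; apply/andP; split; lra.
by move=> [/andP[? ?] /andP[? ?]]; split; apply/andP; split; lra.
Qed.

Lemma eball_square x d : eball x d `<=` square x d.
Proof.
move=> y; rewrite /eball/= => xy; apply/squareP; split; apply: le_trans (ltW xy).
  exact: (fst_le_enorm (vsub y x)).
exact: (snd_le_enorm (vsub y x)).
Qed.

(** The circumscribed square of the ball is the source of the factor [4 * d ^+ 2] in the integral
    bounds below. *)
Lemma leb2_sub_eball A x d : 0 <= d -> measurable (A : set (plane R)) ->
  A `<=` eball x d -> (leb2 A <= (4 * d ^+ 2)%:E)%E.
Proof.
move=> d0 mA Ax; rewrite -(leb2_square x)//.
apply: le_measure; rewrite ?inE//; first exact: measurable_square.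
by apply: (subset_trans Ax); exact: eball_square.
Qed.

Lemma integrable_sub_eball A f x d C : 0 <= d -> measurable (A : set (plane R)) ->
  A `<=` eball x d -> measurable_fun setT (f : plane R -> R) -> (forall y, A y -> `|f y| <= C) ->
  (@leb2 R).-integrable A (EFin \o f).
Proof.
move=> d0 mA Ax mf fC; apply: measurable_bounded_integrable => //.
- by apply: le_lt_trans (leb2_sub_eball d0 mA Ax) _; rewrite ltry.
- exact: measurable_funS mf.
- exists C; split; first exact: num_real.
  by move=> M CM y Ay; apply: le_trans (fC _ Ay) (ltW CM).
Qed.

Lemma sint_le A f x d C : 0 <= d -> 0 <= C -> measurable (A : set (plane R)) ->
  A `<=` eball x d -> measurable_fun setT (f : plane R -> R) -> (forall y, A y -> `|f y| <= C) ->
  `|sint A f| <= C * (4 * d ^+ 2).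
Proof.
move=> d0 C0 mA Ax mf fC.
have mu := leb2_sub_eball d0 mA Ax.
have fint := integrable_sub_eball d0 mA Ax mf fC.
apply: le_trans (le_normr_Rintegral mA fint) _.
apply: (@le_trans _ _ (sint A (fun=> C))).
  apply: le_Rintegral => //.
  - apply: (integrable_sub_eball (C := C) d0 mA Ax) => [|y Ay].
      by apply: measurableT_comp => //; exact: normr_measurable.
    by rewrite normr_id fC.
  - by apply: (integrable_sub_eball (C := C) d0 mA Ax) => // y Ay; rewrite ger0_norm.
rewrite /sint Rintegral_cst//; apply: ler_wpM2l => //.
rewrite -lee_fin fineK// fin_numElt (lt_le_trans _ (measure_ge0 _ _))//=.
by apply: le_lt_trans mu _; rewrite ltry.
Qed.

Lemma sintB_le A f g x d C B : 0 <= d -> 0 <= C -> measurable (A : set (plane R)) ->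
  A `<=` eball x d -> measurable_fun setT (f : plane R -> R) -> measurable_fun setT (g : plane R -> R) ->
  (forall y, A y -> `|f y| <= B) -> (forall y, A y -> `|g y| <= B) ->
  (forall y, A y -> `|f y - g y| <= C) ->
  `|sint A f - sint A g| <= C * (4 * d ^+ 2).
Proof.
move=> d0 C0 mA Ax mf mg fB gB fg.
rewrite /sint -RintegralB//.
- by apply: (sint_le d0 C0 mA Ax) => //; exact: measurable_funB.
- exact: (integrable_sub_eball d0 mA Ax mf fB).
- exact: (integrable_sub_eball d0 mA Ax mg gB).
Qed.

(** Since [f] is nonnegative on [A], discarding the part of [A] outside the square can only lower
    the integral. The bound [B] gives integrability. *)
Lemma sint_ge A f x d B c q s : 0 <= d -> 0 <= s -> measurable (A : set (plane R)) ->
  A `<=` eball x d -> measurable_fun setT (f : plane R -> R) -> (forall y, A y -> `|f y| <= B) ->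
  (forall y, A y -> 0 <= f y) -> square q s `<=` A ->
  (forall y, square q s y -> c <= f y) ->
  c * (4 * s ^+ 2) <= sint A f.
Proof.
move=> d0 s0 mA Ax mf fB f0 qA cf.
have mq : measurable (square q s : set (plane R)) by exact: measurable_square.
have fint := integrable_sub_eball d0 mA Ax mf fB.
have qint g C : measurable_fun setT (g : plane R -> R) -> (forall y, square q s y -> `|g y| <= C) ->
    (@leb2 R).-integrable (square q s) (EFin \o g).
  exact: integrable_sub_eball d0 mq (subset_trans qA Ax).
rewrite -[4 * _]/(fine (4 * s ^+ 2)%:E) -(leb2_square q s0) -Rintegral_cst//.
apply: (@le_trans _ _ (sint (square q s) f)).
  apply: le_Rintegral => //; first exact: (qint _ `|c|).
  by apply: (qint _ B) => // y /qA; exact: fB.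
have -> : A = square q s `|` (A `\` square q s) by rewrite setDUK.
rewrite /sint Rintegral_setU//.
- by rewrite lerDl; apply: Rintegral_ge0 => y [Ay _]; exact: f0.
- exact: measurableD.
- by rewrite setDUK.
- by rewrite disj_set2E setDIK.
Qed.

End PlaneIntegrals.

(** * Squares inside the domain *)

Section InteriorSquares.
Variable R : realType.
Implicit Types (O : set (pt R)) (x b q : pt R) (c d r : R).

(** The continuous function [|g'|] attains its maximum on [[-r, r]], and the mean value theorem
    turns that maximum into a Lipschitz constant. *)
Lemma derivable_lipschitz (g : R -> R) r : (forall s, derivable g s 1) ->
  continuous (derive1 g) -> exists2 L, 0 <= L &
  forall s t, `|s| <= r -> `|t| <= r -> `|g s - g t| <= L * `|s - t|.
Proof.
move=> dg cg.
have [r0|r0] := ltP r 0.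
  by exists 0 => // s t sr; have := normr_ge0 s; lra.
have cn : {within `[-r, r], continuous (fun s => `|derive1 g s|)}.
  apply: continuous_subspaceT => s.
  exact: (continuous_comp (cg s) (@norm_continuous _ _ _)).
have [m _ mmax] := EVT_max (ltac:(lra) : -r <= r) cn.
exists `|derive1 g m| => //.
have key s t : s <= t -> `|s| <= r -> `|t| <= r ->
    `|g t - g s| <= `|derive1 g m| * `|t - s|.
  move=> st sr tr.
  have cont : {within `[s, t], continuous g}.
    by apply: derivable_within_continuous => z _; exact: dg.
  have der z : z \in `]s, t[ -> is_derive z 1 g (derive1 g z).
    by move=> _; rewrite derive1E; exact: derivableP.
  have [z zst ->] := MVT_segment st der cont.
  rewrite normrM ler_wpM2r// mmax//.
  move: zst sr tr; rewrite !in_itv/= !ler_norml.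
  by move=> /andP[? ?] /andP[? ?] /andP[? ?]; apply/andP; split; lra.
move=> s t sr tr; have [st|/ltW ts] := leP s t; last exact: key.
by rewrite distrC [`|s - t|]distrC; exact: key.
Qed.

(* Below the graph of an L-Lipschitz function, the ball of radius d around a
   point contains the ball centred d/2 further down, of radius d/(4(1+L)). *)
Lemma chart_inner_square O b r (e1 e2 : pt R) (g : R -> R) :
  C3fun g -> is_chart O b r e1 e2 g ->
  exists2 c, 0 < c & forall x, O x -> enorm (vsub x b) < r / 2 ->
    forall d, 0 < d -> d < r / 2 ->
    exists q, square q (c * d) `<=` eball x d `&` O.
Proof.
move=> [g3 _] [r0 [[e11 [e22 e12]] chart]].
have dg s : derivable g s 1 by have := g3 0%N isT s.
have cg : continuous (derive1 g).
  by move=> s; apply: differentiable_continuous; apply/derivable1_diffP; exact: (g3 1%N isT s).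
have [L L0 gL] := derivable_lipschitz r dg cg.
(* A square of half-side [c * d] lies within [2 * (c * d) = d / (4 * (1 + L))] of its centre, by the
   l1 bound on the norm. *)
exists (8 * (1 + L))^-1; first by rewrite invr_gt0; lra.
set c := (8 * (1 + L))^-1.
have c0 : 0 < c by rewrite invr_gt0; lra.
have cL : c * (1 + L) = 1 / 8 by rewrite /c; field; lra.
have c8 : c <= 1 / 8 by rewrite -cL ler_peMr//; lra.
move=> x Ox xb d d0 dr.
exists (vsub x (smul (d / 2) e2)) => y /squareP[y1 y2].
set q := vsub x _ in y1 y2.
have en1 : enorm e1 = 1 by rewrite /enorm e11 sqrtr1.
have en2 : enorm e2 = 1 by rewrite /enorm e22 sqrtr1.
set w := vsub y q.
have wn : enorm w <= 2 * (c * d).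
  by apply: le_trans (enorm_le_l1 _) _; rewrite mulr2n mulrDl mul1r lerD.
have yx : enorm (vsub y x) < d.
  have -> : vsub y x = vadd w (smul (- (d / 2)) e2).
    by rewrite /w /q /vadd /vsub /smul/=; congr pair; ring.
  apply: le_lt_trans (enormD _ _) _.
  rewrite enorm_smul_unit// normrN ger0_norm; last lra.
  have : c * d <= 1 / 8 * d by rewrite ler_wpM2r// ltW.
  by lra.
have yb : enorm (vsub y b) < r.
  have -> : vsub y b = vadd (vsub y x) (vsub x b).
    by rewrite /vadd /vsub/=; congr pair; ring.
  by apply: le_lt_trans (enormD _ _) _; lra.
split => //; apply/chart => //.
have xO := iffLR (chart x ltac:(lra)) Ox.
have d1 : `|dot w e1| <= 2 * (c * d).
  by apply: le_trans (dot_le_enorm _ _) _; rewrite en1 mulr1.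
have d2 : `|dot w e2| <= 2 * (c * d).
  by apply: le_trans (dot_le_enorm _ _) _; rewrite en2 mulr1.
have E2 : dot (vsub y b) e2 = dot (vsub x b) e2 + dot w e2 - d / 2.
  have -> : d / 2 = d / 2 * dot e2 e2 by rewrite e22 mulr1.
  by rewrite /w /q /dot /vsub /smul/=; ring.
have E1 : dot (vsub y b) e1 - dot (vsub x b) e1 = dot w e1.
  have -> : dot w e1 = dot w e1 - d / 2 * dot e1 e2 by rewrite e12 mulr0 subr0.
  by rewrite /w /q /dot /vsub /smul/=; ring.
have absE (z : pt R) : enorm z < r -> `|dot z e1| <= r.
  by move=> zr; apply: le_trans (dot_le_enorm _ _) _; rewrite en1 mulr1 ltW.
have gg := gL _ _ (absE _ yb) (absE _ (ltac:(lra) : enorm (vsub x b) < r)).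
rewrite E1 distrC in gg.
have gb : `|g (dot (vsub x b) e1) - g (dot (vsub y b) e1)| <= L * (2 * (c * d)).
  by apply: le_trans gg _; rewrite ler_wpM2l.
move: gb d2; rewrite E2 !ler_norml => /andP[_ gb] /andP[_ d2].
(* The centre is lowered by [d / 2]; the offset [w] regains at most [2 * (c * d)] and the graph
   falls by at most [L * (2 * (c * d))], together [d / 4]. *)
have : (c * (1 + L)) * d = 1 / 8 * d by rewrite cL.
nra.
Qed.

Lemma compact_square q r : compact (square q r).
Proof. by apply: compact_setX; exact: segment_compact. Qed.

Lemma bounded_sub_square O : bounded_set O -> exists r, O `<=` square (0, 0) r.
Proof.
move=> [M [_ OM]]; exists (M + 1) => -[y1 y2] Oy; apply/squareP.
have := OM (M + 1) ltac:(lra) _ Oy.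
by rewrite /Num.Def.normr/= ge_max !subr0 => /andP[? ?].
Qed.

(** [bdry O] is closed because [O] is open, and a closed square containing [O] also contains its
    closure. *)
Lemma compact_bdry O : open O -> bounded_set O -> compact (bdry O).
Proof.
move=> oO /bounded_sub_square[r Or].
have cl : closed (square ((0, 0) : R * R) r).
  apply: compact_closed; last exact: compact_square.
  exact: norm_hausdorff.
apply: (@subclosed_compact _ _ (square (0, 0) r)).
- apply: closedI; first exact: closed_closure.
  exact: open_closedC.
- exact: compact_square.
- by move=> y [Oy _]; rewrite (iffLR (closure_id _) cl); exact: closure_subset Or _ Oy.
Qed.

(** A chart at [b] serves all boundary points near [b] and all small enough constants [c]. This is
    the local hypothesis of the covering form of compactness, which yields one [c] for the whole
    boundary. The same [c] limits the scale [d] and fixes the relative size of the square. *)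
Lemma uniform_inner_square O : open O -> bounded_set O -> C3_boundary O ->
  exists2 c, 0 < c & forall x b, O x -> bdry O b ->
    forall d, 0 < d -> d < c -> enorm (vsub x b) < d ->
    exists q, square q (c * d) `<=` eball x d `&` O.
Proof.
move=> oO bO C3O.
have /compact_near_coveringP cov := compact_bdry oO bO.
pose P (c : R) (b : pt R) := forall x, O x -> enorm (vsub x b) < c ->
  forall d, 0 < d -> d < c -> exists q, square q (c * d) `<=` eball x d `&` O.
have loc b : bdry O b -> \forall b' \near b & c \near 0^'+, P c b'.
  move=> /C3O [r [e1 [e2 [g [g3 ch]]]]].
  have [c0 c00 sq] := chart_inner_square g3 ch.
  have r0 : 0 < r by case: ch.
  (* A point [b'] of the sup-norm ball of radius [r / 8] is at Euclidean distance at most [r / 4]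
     from [b]; with [c < r / 4], [x] stays within [r / 2] of [b]. The bound by [c0] shrinks the
     square. *)
  pose m := Num.min c0 (r / 4).
  have m0 : 0 < m by rewrite lt_min c00/= divr_gt0.
  exists (ball b (r / 8), [set c | 0 < c < m]).
    split => /=; first by apply: nbhsx_ballx; lra.
    by near=> c; apply/andP; split; near: c; [exact: nbhs_right_gt|exact: nbhs_right_lt].
  move=> [b' c] [/= [b1 b2] /andP[cpos cm]] x Ox xb' d d0 dc.
  move: cm; rewrite lt_min => /andP[cc0 cr].
  have xb : enorm (vsub x b) < r / 2.
    have -> : vsub x b = vadd (vsub x b') (vsub b' b).
      by rewrite /vadd /vsub/=; congr pair; ring.
    apply: le_lt_trans (enormD _ _) _.
    have : enorm (vsub b' b) <= r / 4.
      apply: le_trans (enorm_le_l1 _) _; rewrite /vsub/= distrC [`|b'.2 - _|]distrC.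
      by move: b1 b2; rewrite /ball/= => b1 b2; lra.
    by lra.
  have [|q qs] := sq x Ox xb d d0; first by lra.
  exists q => y /squareP[y1 y2]; apply: qs; apply/squareP.
  have : c * d <= c0 * d by rewrite ler_wpM2r// ltW.
  by split; lra.
have near_c := cov R (0^'+) P _ loc.
have [c [c0 Pc]] : exists c : R, 0 < c /\ bdry O `<=` P c.
  near (0 : R)^'+ => c; exists c; split; first by near: c; exact: nbhs_right_gt.
  by near: c; exact: near_c.
exists c => // x b Ox bb d d0 dc xb.
by apply: (Pc b bb x Ox) => //; exact: lt_trans xb dc.
Unshelve. all: by end_near. Qed.

End InteriorSquares.

(** * The corrected dilatation *)

Section Dilatation.
Variable R : realType.
Implicit Types (O : set (pt R)) (u : pt R -> pt R) (x z q : pt R) (d r : R).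

Lemma kern_ge0 d r : 0 <= kern d r.
Proof. by rewrite /kern; case: ifP => // /andP[/ltW]; rewrite invr_ge0. Qed.

Lemma kern_sqr d r : 0 <= r -> r <= d -> kern d r * r ^+ 2 = r.
Proof.
rewrite /kern le_eqVlt => /predU1P[<-|r0] rd; first by rewrite expr0n mulr0.
by rewrite r0 rd/= expr2 mulKf// gt_eqF.
Qed.

(** On the punctured ball the kernel is at least [d^-1]; at the origin, where it vanishes, so does
    the quadratic form. *)
Lemma kern_form_ge d z (k : pt R) : 0 < d -> enorm z <= d ->
  d^-1 * dot k z ^+ 2 <= kern d (enorm z) * dot k z ^+ 2.
Proof.
move=> d0 zd; have [z0|/negPf z0] := eqVneq (enorm z) 0.
  have := dot_le_enorm k z; rewrite z0 mulr0 normr_le0 => /eqP ->.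
  by rewrite expr0n !mulr0.
have zp : 0 < enorm z by rewrite lt_neqAle eq_sym z0 enorm_ge0.
rewrite ler_wpM2r ?sqr_ge0// /kern zp zd/=.
by rewrite lef_pV2 ?posrE.
Qed.

Lemma mdelta_bounds d : 0 < d -> d ^+ 3 / 64 <= mdelta d <= 4 * d ^+ 3.
Proof.
move=> d0; pose f (z : pt R) := kern d (enorm z) * enorm z ^+ 2.
have v0 z : vsub z (0, 0) = z by case: z => a b; rewrite /vsub/= !subr0.
have fE z : eball (0, 0) d z -> f z = enorm z.
  by rewrite /eball/= v0 => /ltW zd; rewrite /f kern_sqr// enorm_ge0.
have mf : measurable_fun setT (f : plane R -> R).
  have -> : f = (fun z => kern d (enorm (vsub z (0, 0))) * enorm (vsub z (0, 0)) ^+ 2).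
    by apply/funext => z; rewrite v0.
  apply: measurable_funM; first exact: measurable_kern.
  by apply: measurable_funX; exact: measurable_enorm.
have mB : measurable (eball (0, 0) d : set (plane R)) by exact: measurable_eball.
have fd z : eball (0, 0) d z -> `|f z| <= d.
  by move=> Bz; rewrite fE// ger0_norm ?enorm_ge0//; move: Bz; rewrite /eball/= v0 => /ltW.
apply/andP; split.
  (* On the square of half-side [d / 8] around [(3 / 8 * d, 3 / 8 * d)] both coordinates run from
     [d / 4] to [d / 2], so the square lies in the ball and [enorm z] is at least [d / 4] there. *)
  have -> : d ^+ 3 / 64 = d / 4 * (4 * (d / 8) ^+ 2) by field.
  apply: (@sint_ge _ _ _ (0, 0) d d _ (3 / 8 * d, 3 / 8 * d)) => //; try lra.
  - by move=> z _; rewrite mulr_ge0 ?kern_ge0// exprn_ge0// enorm_ge0.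
  - move=> z /squareP[/=]; rewrite !ler_norml => /andP[a1 a2] /andP[b1 b2].
    rewrite /eball/= v0 -(@ltr_pXn2r _ 2)// ?nnegrE ?enorm_ge0// ?(ltW d0)//.
    by rewrite sqr_enorm /dot; nra.
  - move=> z zS; rewrite -/(f z) fE; last first.
      move: zS => /squareP[/=]; rewrite !ler_norml => /andP[a1 a2] /andP[b1 b2].
      rewrite /eball/= v0 -(@ltr_pXn2r _ 2)// ?nnegrE ?enorm_ge0// ?(ltW d0)//.
      by rewrite sqr_enorm /dot; nra.
    apply: le_trans (fst_le_enorm z); move: zS => /squareP[/=]; rewrite !ler_norml.
    by move=> /andP[a1 a2] _; rewrite ler_normr; apply/orP; left; lra.
have -> : 4 * d ^+ 3 = d * (4 * d ^+ 2) by ring.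
apply: le_trans (ler_norm _) _.
exact: (@sint_le _ _ f (0, 0)) (ltW d0) (ltW d0) mB _ mf fd.
Qed.

(* The corner is the one towards which |k.(y - x)| increases, starting from the
   centre q. *)
Lemma corner_square q (s : R) x (k : pt R) : 0 <= s -> exists2 q',
  square q' (s / 4) `<=` square q s &
  forall y, square q' (s / 4) y ->
    s ^+ 2 / 4 * dot k k <= dot k (vsub y x) ^+ 2.
Proof.
(* Both sides of the inequality are even in [k]. *)
move=> s0; wlog kq : k / 0 <= dot k (vsub q x).
  move=> H; have [|/ltW kq] := leP 0 (dot k (vsub q x)); first exact: H.
  have [|q' qq' h] := H (smul (-1) k).
    by rewrite (_ : dot (smul (-1) k) _ = - dot k (vsub q x)) ?oppr_ge0// /dot/=; ring.
  exists q' => // y /h; rewrite /dot /smul/=; lra.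
(* A shift by [3 / 4 * s] in the direction of the sign puts a square of half-side [s / 4] into the
   corner, where each coordinate differs from that of [q] by at least [s / 2]. *)
pose sg (t : R) : R := if 0 <= t then 1 else -1.
have sg_mul t (y p : R) : `|y - (p + sg t * (3 / 4 * s))| <= s / 4 ->
    `|y - p| <= s /\ s / 2 * `|t| <= t * (y - p).
  rewrite /sg; case: ifPn => t0; rewrite !ler_norml => /andP[y1 y2].
    by rewrite ger0_norm//; split; [apply/andP; split; lra|nra].
  move: t0; rewrite -ltNge => t0.
  by rewrite ltr0_norm//; split; [apply/andP; split; lra|nra].
exists (q.1 + sg k.1 * (3 / 4 * s), q.2 + sg k.2 * (3 / 4 * s)).
  by move=> y /squareP[/sg_mul[y1 _] /sg_mul[y2 _]]; apply/squareP.
move=> y /squareP[/sg_mul[_ y1] /sg_mul[_ y2]].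
have ge : s / 2 * (`|k.1| + `|k.2|) <= dot k (vsub y x).
  by move: kq; rewrite /dot /vsub/=; lra.
apply: (@le_trans _ _ ((s / 2 * (`|k.1| + `|k.2|)) ^+ 2)).
  rewrite exprMn sqrrD !real_normK ?num_real// /dot.
  have : 0 <= s ^+ 2 * (`|k.1| * `|k.2|) by rewrite mulr_ge0 ?sqr_ge0// mulr_ge0.
  by lra.
by rewrite ler_pXn2r// ?nnegrE ?(le_trans _ ge)// !mulr_ge0// ?addr_ge0//; lra.
Qed.

(* Test the form at (-b, a). *)
Lemma det_ge_of_form (a b d kap : R) : 0 < kap ->
  (forall s t, kap * (s ^+ 2 + t ^+ 2) <= a * s ^+ 2 + 2 * b * s * t + d * t ^+ 2) ->
  kap ^+ 2 <= a * d - b * b.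
Proof.
move=> k0 form.
have ak : kap <= a by have := form 1 0; lra.
have h : kap * a ^+ 2 <= a * (a * d - b * b).
  have := form (- b) a; have : 0 <= kap * b ^+ 2 by rewrite mulr_ge0 ?sqr_ge0// ltW.
  by lra.
have : kap * a <= a * d - b * b.
  by rewrite -(@ler_pM2l _ a); [lra|exact: lt_le_trans ak].
by nra.
Qed.

(** Up to the factor [dim2 / m], the matrix inverted in [theta_corr], kept in the same syntactic
    form so that the two agree by conversion. *)
Definition gram (A : set (pt R)) x d (i j : bool) : R :=
  sint A (fun y => let z := vsub y x in
    kern d (enorm z) * (if i then z.1 else z.2) * (if j then z.1 else z.2)).

Definition component (i : bool) z : R := if i then z.1 else z.2.

Lemma component_le i z : `|component i z| <= enorm z.
Proof. by case: i; [exact: fst_le_enorm|exact: snd_le_enorm]. Qed.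

Lemma measurable_gram x d i j : measurable_fun setT
  ((fun y => kern d (enorm (vsub y x)) * component i (vsub y x) * component j (vsub y x))
     : plane R -> R).
Proof.
have mc k : measurable_fun setT ((fun y => component k (vsub y x)) : plane R -> R).
  by case: k; [apply: (measurableT_comp measurable_fst)|
    apply: (measurableT_comp measurable_snd)]; exact: measurable_vsub.
by apply: measurable_funM; [apply: measurable_funM|]; [exact: measurable_kern|exact: mc..].
Qed.

Lemma gram_integrand_le x d y i j : eball x d y ->
  `|kern d (enorm (vsub y x)) * component i (vsub y x) * component j (vsub y x)| <= d.
Proof.
rewrite /eball/= => /ltW yd; apply: (le_trans _ yd).
rewrite -[leRHS](kern_sqr (enorm_ge0 _) yd) -mulrA normrM ger0_norm ?kern_ge0//.
by rewrite ler_wpM2l ?kern_ge0// normrM expr2 ler_pM// component_le.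
Qed.

Section Gram.
Variables (A : set (pt R)) (x : pt R) (d : R).
Hypotheses (d0 : 0 < d) (mA : measurable (A : set (plane R))) (Ax : A `<=` eball x d).

Let g i j : pt R -> R := fun y =>
  kern d (enorm (vsub y x)) * component i (vsub y x) * component j (vsub y x).

Let gram_int i j : (@leb2 R).-integrable A (EFin \o g i j).
Proof.
apply: (integrable_sub_eball (C := d) (ltW d0) mA Ax); first exact: measurable_gram.
by move=> y /Ax; exact: gram_integrand_le.
Qed.

Lemma gram_le i j : `|gram A x d i j| <= 4 * d ^+ 3.
Proof.
have -> : 4 * d ^+ 3 = d * (4 * d ^+ 2) by ring.
apply: (@sint_le _ _ (g i j) x) => //; try exact: ltW; first exact: measurable_gram.
by move=> y /Ax; exact: gram_integrand_le.
Qed.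

Lemma gram_sym i j : gram A x d i j = gram A x d j i.
Proof.
apply: eq_Rintegral => y _ /=; rewrite -!mulrA; congr (_ * _).
exact: mulrC.
Qed.

(** The form is the integral of [K * (k.z) ^+ 2]. On the corner square, of area [s ^+ 2 / 4], the
    kernel is at least [d^-1] and [(k.z) ^+ 2] at least [s ^+ 2 / 4 * dot k k]. *)
Lemma gram_form_ge q (s : R) (k : pt R) : 0 <= s -> square q s `<=` A ->
  s ^+ 4 / (16 * d) * (k.1 ^+ 2 + k.2 ^+ 2) <= gram A x d true true * k.1 ^+ 2 +
    2 * gram A x d true false * k.1 * k.2 + gram A x d false false * k.2 ^+ 2.
Proof.
move=> s0 qA.
have mg i j := @measurable_gram x d i j.
pose f (y : pt R) := kern d (enorm (vsub y x)) * dot k (vsub y x) ^+ 2.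
have mf : measurable_fun setT (f : plane R -> R).
  apply: measurable_funM; first exact: measurable_kern.
  by apply: measurable_funX; apply: measurable_dot => //; exact: measurable_vsub.
have fE y : f y = k.1 ^+ 2 * g true true y + 2 * k.1 * k.2 * g true false y +
    k.2 ^+ 2 * g false false y.
  by rewrite /f /g /dot /=; ring.
have intZ (t : R) i j : (@leb2 R).-integrable A (EFin \o (fun y => t * g i j y)).
  by have := integrableZl mA t (gram_int i j); rewrite /comp.
have -> : gram A x d true true * k.1 ^+ 2 + 2 * gram A x d true false * k.1 * k.2 +
    gram A x d false false * k.2 ^+ 2 = sint A f.
  transitivity (sint A (fun y => k.1 ^+ 2 * g true true y +
    2 * k.1 * k.2 * g true false y + k.2 ^+ 2 * g false false y)); last first.
    by apply: eq_Rintegral => y _; exact/esym/fE.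
  rewrite /sint RintegralD//; last first.
    by have := integrableD mA (intZ (k.1 ^+ 2) true true) (intZ (2 * k.1 * k.2) true false); rewrite /comp.
  rewrite RintegralD// !RintegralZl//.
  rewrite /gram /sint /g /component; ring.
have [q' q'q h] := corner_square q x k s0.
have -> : s ^+ 4 / (16 * d) * (k.1 ^+ 2 + k.2 ^+ 2) =
    (d^-1 * (s ^+ 2 / 4 * dot k k)) * (4 * (s / 4) ^+ 2).
  by rewrite /dot; field; rewrite gt_eqF.
have s40 : 0 <= s / 4 by rewrite divr_ge0.
apply: (sint_ge (B := d * dot k k) (ltW d0) s40 mA Ax mf).
- move=> y /Ax yx; rewrite ger0_norm; last by apply: mulr_ge0; [exact: kern_ge0|exact: sqr_ge0].
  have yd : enorm (vsub y x) <= d by exact: ltW.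
  apply: (@le_trans _ _ (kern d (enorm (vsub y x)) * enorm (vsub y x) ^+ 2 * dot k k)).
    rewrite -mulrA ler_wpM2l ?kern_ge0// -!sqr_enorm -exprMn -real_normK ?num_real//.
    by rewrite ler_pXn2r// ?nnegrE ?mulr_ge0 ?enorm_ge0// mulrC dot_le_enorm.
  by rewrite kern_sqr ?enorm_ge0// ler_wpM2r// -sqr_enorm sqr_ge0.
- by move=> y _; apply: mulr_ge0; [exact: kern_ge0|exact: sqr_ge0].
- exact: subset_trans q'q qA.
- move=> y yq'; have yd : enorm (vsub y x) <= d by apply: ltW; exact: (Ax (qA _ (q'q _ yq'))).
  apply: le_trans (kern_form_ge k d0 yd).
  by rewrite ler_wpM2l ?invr_ge0 ?(ltW d0)// h.
Qed.

End Gram.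

(** Gram entries are of order [d ^+ 3], so this makes the normalised matrix independent of scale. *)
Lemma dim_mdelta_bounds d : 0 < d -> 1 / 2 <= dim2 R / mdelta d * d ^+ 3 <= 128.
Proof.
move=> d0; have /andP[m1 m2] := mdelta_bounds d0.
have d30 : 0 < d ^+ 3 by rewrite exprn_gt0.
have m0 : 0 < mdelta d by apply: lt_le_trans m1; rewrite divr_gt0.
rewrite mulrAC ler_pdivlMr// ler_pdivrMr// /dim2.
by apply/andP; split; lra.
Qed.

(** Cramer's rule: the normalised entries are at most [128 * 4 = 512] and the determinant is at
    least [kap ^+ 2]. With [u] Lipschitz the integrand is at most a multiple of
    [L * K * |z| ^+ 2 = L * |z|], hence of [L * d]; the area [4 * d ^+ 2] and the factor [dim2 / m],
    of order [d ^- 3], remove the scale. *)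
Lemma theta_corr_le O u x d (c L : R) q : 0 < c -> 0 < d -> 0 <= L -> open O ->
  continuous u -> square q (c * d) `<=` eball x d `&` O ->
  (forall y, (eball x d `&` O) y ->
    enorm (vsub (u y) (u x)) <= L * enorm (vsub y x)) ->
  `|theta_corr O u d x| <= 2 ^+ 20 * L / (c ^+ 4 / 32) ^+ 2.
Proof.
move=> c0 d0 L0 oO cu qA uL; set A := _ `&` O in qA uL.
have mA : measurable (A : set (plane R)).
  by apply: measurableI; [exact: measurable_eball|exact: open_measurable_prod].
have Ax : A `<=` eball x d by move=> y [].
have /andP[rho1 rho2] := dim_mdelta_bounds d0.
set rho := dim2 R / mdelta d in rho1 rho2.
have d30 : 0 < d ^+ 3 by rewrite exprn_gt0.
have rho0 : 0 < rho by rewrite -(pmulr_lgt0 _ d30); lra.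
(* This is [(c * d) ^+ 4 / (16 * d)] from [gram_form_ge], times the lower bound [1 / (2 * d ^+ 3)]
   for [rho]. *)
set kap := c ^+ 4 / 32; have kap0 : 0 < kap by rewrite divr_gt0// exprn_gt0.
set a := rho * gram A x d true true.
set b := rho * gram A x d true false.
set e := rho * gram A x d false false.
set b' := rho * gram A x d false true.
have bb' : b' = b by rewrite /b' gram_sym.
have -> : theta_corr O u d x = rho * sint A (fun y => kern d (enorm (vsub y x)) *
    dot (vsub y x)
      ((e * (vsub (u y) (u x)).1 - b * (vsub (u y) (u x)).2) / (a * e - b * b'),
       (a * (vsub (u y) (u x)).2 - b' * (vsub (u y) (u x)).1) / (a * e - b * b'))) by [].
rewrite bb'.
have GB i j : `|rho * gram A x d i j| <= 512.
  rewrite normrM (gtr0_norm rho0).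
  apply: (@le_trans _ _ (rho * (4 * d ^+ 3))); last lra.
  by apply: ler_wpM2l (gram_le d0 mA Ax i j); exact: ltW.
have det_ge : kap ^+ 2 <= a * e - b * b.
  apply: det_ge_of_form => // s t.
  have cd0 : 0 <= c * d by rewrite mulr_ge0// ltW.
  have := gram_form_ge d0 mA Ax (s, t) cd0 qA => /= /(ler_wpM2l (ltW rho0)).
  rewrite (_ : rho * _ = 2 * kap * (rho * d ^+ 3) * (s ^+ 2 + t ^+ 2)); last first.
    by rewrite /kap; field; rewrite gt_eqF.
  have : 2 * kap * (1 / 2) * (s ^+ 2 + t ^+ 2) <=
      2 * kap * (rho * d ^+ 3) * (s ^+ 2 + t ^+ 2).
    by rewrite ler_wpM2r ?addr_ge0 ?sqr_ge0// ler_wpM2l// mulr_ge0// ltW.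
  by rewrite /a /b /e; lra.
set det := a * e - b * b in det_ge *.
have k20 : 0 < kap ^+ 2 by rewrite exprn_gt0.
have det0 : 0 < det by exact: lt_le_trans det_ge.
have Minv_le (p r : R) (w : pt R) i j : `|p| <= 512 -> `|r| <= 512 ->
    `|(p * component i w - r * component j w) / det| <= 1024 * enorm w / kap ^+ 2.
  move=> pB rB; rewrite normrM normfV (gtr0_norm det0).
  apply: ler_pM => //; first by rewrite invr_ge0 ltW.
    apply: le_trans (ler_normB _ _) _; rewrite !normrM.
    have := ler_pM (normr_ge0 _) (normr_ge0 _) pB (component_le i w).
    have := ler_pM (normr_ge0 _) (normr_ge0 _) rB (component_le j w).
    by lra.
  by rewrite lef_pV2 ?posrE.
have Q0 : 0 <= L / kap ^+ 2 by apply: divr_ge0 => //; exact: ltW.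
have N0 : 0 <= 2048 * (L / kap ^+ 2) by apply: mulr_ge0; [exact: ler0n|].
(* Two components of [z], each paired with a component of the inverse applied to [w], itself at most
   [1024 * enorm w / kap ^+ 2]. *)
pose B := 2048 * (L / kap ^+ 2) * d.
have B0 : 0 <= B by apply: mulr_ge0; [exact: N0|exact: ltW].
rewrite normrM (gtr0_norm rho0).
apply: (@le_trans _ _ (rho * (B * (4 * d ^+ 2)))); last first.
  (* With [rho * d ^+ 3 <= 128] the constant becomes [8 * 1024 * 128 = 2 ^+ 20]. *)
  rewrite (_ : rho * _ = 8 * 1024 * (L / kap ^+ 2) * (rho * d ^+ 3)); last by rewrite /B; ring.
  by have := ler_wpM2l Q0 rho2; lra.
apply: ler_wpM2l; first exact: ltW.
have mv i : measurable_fun setT ((fun y => component i (vsub (u y) (u x))) : plane R -> R).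
  apply: continuous_measurable_prod => y.
  by case: i; apply: cvgB; try exact: cvg_cst; apply: cvg_comp (cu y) _;
    [exact: cvg_fst|exact: cvg_snd].
apply: (sint_le (ltW d0) B0 mA Ax).
  apply: measurable_funM; first exact: measurable_kern.
  apply: measurable_dot; first exact: measurable_vsub.
  apply/measurable_fun_pairP; split; apply: measurable_funM => //; apply: measurable_funB;
    by apply: measurable_funM => //; exact: (mv true) || exact: (mv false).
move=> y Ay; have yd : enorm (vsub y x) <= d by apply: ltW; exact: (Ax _ Ay).
rewrite normrM (ger0_norm (kern_ge0 _ _)).
set z := vsub y x in yd *; set w := vsub (u y) (u x).
have w_le : enorm w <= L * enorm z by exact: uL.
apply: (@le_trans _ _ (kern d (enorm z) * (2048 * (L / kap ^+ 2) * enorm z ^+ 2))).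
  apply: ler_wpM2l; first exact: kern_ge0.
  rewrite /dot /=; apply: le_trans (ler_normD _ _) _; rewrite !normrM.
  have M1 := Minv_le e b w true false (GB _ _) (GB _ _).
  have M2 := Minv_le a b w false true (GB _ _) (GB _ _).
  have N1 := ler_pM (normr_ge0 _) (normr_ge0 _) (component_le true z) M1.
  have N2 := ler_pM (normr_ge0 _) (normr_ge0 _) (component_le false z) M2.
  rewrite /component !normrM in N1 N2.
  apply: le_trans (lerD N1 N2) _.
  rewrite (_ : _ + _ = 2048 * (enorm z / kap ^+ 2) * enorm w); last by ring.
  rewrite (_ : 2048 * (L / _) * _ = 2048 * (enorm z / kap ^+ 2) * (L * enorm z)); last by ring.
  apply: ler_wpM2l w_le; apply: mulr_ge0; first exact: ler0n.
  by apply: divr_ge0; [exact: enorm_ge0|exact: ltW].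
rewrite mulrCA kern_sqr ?enorm_ge0//.
exact: ler_wpM2l N0 _ _ yd.
Qed.

End Dilatation.

(** * Bounds on C^1 fields *)

Section C1Fields.
Variable R : realType.
Implicit Types (u : pt R -> pt R) (x y v : pt R) (r : R).

Lemma C1field_continuous u : C1field u -> continuous u.
Proof. by move=> [du _] x; exact: differentiable_continuous. Qed.

(** Continuity is given direction by direction: the derivatives along the two axes are bounded on
    the compact square, and linearity of the differential recombines them. *)
Lemma C1field_deriv_le u r : C1field u -> exists2 B, 0 <= B &
  forall x v, square (0, 0) r x -> enorm ('D_v u x) <= B * enorm v.
Proof.
move=> [du cDu].
have bnd v : exists2 B, 0 <= B &
    forall x, square (0, 0) r x -> enorm ('D_v u x) <= B.
  have cpt : compact ('D_v u @` square (0, 0) r).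
    apply: continuous_compact; last exact: compact_square.
    by apply: continuous_subspaceT; exact: cDu.
  have [M [_ MB]] := compact_bounded cpt.
  exists (2 * (`|M| + 1)) => [|x xr]; first by rewrite mulr_ge0// addr_ge0.
  have := MB (`|M| + 1) ltac:(by have := ler_norm M; lra) ('D_v u x) ltac:(by exists x).
  rewrite /Num.Def.normr/= ge_max => /andP[h1 h2].
  by apply: le_trans (enorm_le_l1 _) _; move: h1 h2; rewrite /Num.Def.normr/=; lra.
have [B1 B10 h1] := bnd (1, 0).
have [B2 B20 h2] := bnd (0, 1).
exists (B1 + B2) => [|x v xr]; first exact: addr_ge0.
have -> : 'D_v u x = vadd (smul v.1 ('D_(1, 0) u x)) (smul v.2 ('D_(0, 1) u x)).
  rewrite !deriveE//.
  rewrite {1}(_ : v = v.1 *: (1, 0) + v.2 *: (0, 1)).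
    by rewrite linearD !linearZ.
  by case: v => a b; rewrite /GRing.add /GRing.scale /= /add_pair /scale_pair /=; congr pair; rewrite /GRing.scale/=; ring.
move: ('D_(1, 0) u x) ('D_(0, 1) u x) (h1 x xr) (h2 x xr) => D1 D2 D1B D2B.
apply: le_trans (enormD _ _) _; rewrite !enorm_smul.
have := ler_pM (normr_ge0 _) (enorm_ge0 _) (fst_le_enorm v) D1B.
have := ler_pM (normr_ge0 _) (enorm_ge0 _) (snd_le_enorm v) D2B.
by lra.
Qed.

(** The mean value theorem is applied to each component of [u] along the segment from [x] to [y]. It
    is a square that contains the segment, by convexity; the domain itself may fail to be convex.
    Summing the two components gives the factor 2. *)
Lemma C1field_lipschitz u r : C1field u -> exists2 L, 0 <= L &
  forall x y, square (0, 0) r x -> square (0, 0) r y ->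
    enorm (vsub (u y) (u x)) <= L * enorm (vsub y x).
Proof.
move=> uC1; have [B B0 hB] := C1field_deriv_le r uC1.
have [du _] := uC1.
exists (2 * B) => [|x y xr yr]; first by rewrite mulr_ge0.
pose v : R * R := vsub y x.
pose p (t : R) : R * R := t *: v + x.
have cc i : continuous (component i : R * R -> R).
  by case: i => z; [exact: cvg_fst|exact: cvg_snd].
(* The difference quotient along the segment is a component of the quotient defining the directional
   derivative, and components are continuous. *)
have der i (t : R) : is_derive t 1 (fun t => component i (u (p t)) : R) (component i ('D_v u (p t))).
  have cvgu : h^-1 *: (u (h *: v + p t) - u (p t)) @[h --> 0^'] --> 'D_v u (p t).
    exact: diff_derivable (du (p t)).
  have cvgf : h^-1 *: (component i (u (p (h *: 1 + t))) - component i (u (p t))) @[h --> 0^']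
      --> component i ('D_v u (p t)).
    have -> : (fun h : R => h^-1 *: (component i (u (p (h *: 1 + t))) - component i (u (p t)))) =
        component i \o (fun h => h^-1 *: (u (h *: v + p t) - u (p t))).
      apply/funext => h /=.
      have -> : p (h *: 1 + t) = h *: v + p t.
        by rewrite /p scalerDl addrA /GRing.scale/= mulr1.
      by case: i.
    exact: cvg_comp cvgu (cc i _).
  apply: DeriveDef; first by apply/cvg_ex; exists (component i ('D_v u (p t))).
  exact: cvg_lim cvgf.
have pr (t : R) : 0 <= t -> t <= 1 -> square (0, 0) r (p t).
  move=> t0 t1; move: xr yr => /squareP[/= + +] /squareP[/=].
  rewrite !subr0 !ler_norml => /andP[? ?] /andP[? ?] /andP[? ?] /andP[? ?].
  apply/squareP; rewrite /p /v /vsub /= !subr0 !ler_norml /GRing.scale/=.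
  by split; apply/andP; split; nra.
have ci i : `|component i (vsub (u y) (u x))| <= B * enorm (vsub y x).
  have cont : {within `[0, 1], continuous (fun t => component i (u (p t)) : R)}.
    by apply: derivable_within_continuous => t _; case: (der i t).
  have [t] := MVT_segment (ler01) (fun t _ => der i t) cont.
  rewrite in_itv/= => /andP[t0 t1]; rewrite subr0 mulr1 => E.
  have -> : component i (vsub (u y) (u x)) = component i ('D_v u (p t)).
    rewrite -E /p scale0r add0r scale1r.
    have -> : v + x = y.
      by rewrite /v /vsub; case: (x) (y) => ? ? [? ?]; rewrite /GRing.add/= /add_pair/= !subrK.
    by case: i {cont E}.
  by apply: le_trans (component_le _ _) _; apply: hB; exact: pr.
have := ci true; have := ci false; rewrite /component => c1 c2.
by apply: le_trans (enorm_le_l1 _) _; lra.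
Qed.

(** The tractions multiply perturbed factors in the load, so their size enters its variation. *)
Lemma trac_bounded u lam mu r : C1field u -> exists2 B, 0 <= B &
  forall x n p, square (0, 0) r x -> enorm n = 1 -> enorm p = 1 ->
    `|tracP u mu n p x| <= B /\ `|tracN u lam mu n x| <= B.
Proof.
move=> uC1; have [B B0 hB] := C1field_deriv_le r uC1.
exists (`|mu| * (2 * B) + `|lam| * (2 * B)) => [|x n p xr n1 p1].
  by rewrite addr_ge0 ?mulr_ge0.
have dc w v : enorm w = 1 -> enorm v = 1 -> `|Defs.dcomp u w v x| <= B.
  move=> w1 v1; apply: le_trans (dot_le_enorm _ _) _.
  by rewrite w1 mulr1; have := hB x v xr; rewrite v1 mulr1.
have e1 : enorm ((1 : R), (0 : R)) = 1.
  by rewrite /enorm /dot/= mulr0 mulr1 addr0 sqrtr1.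
have e2 : enorm ((0 : R), (1 : R)) = 1.
  by rewrite /enorm /dot/= mulr0 mulr1 add0r sqrtr1.
have dv : `|divergence u x| <= 2 * B.
  apply: le_trans (ler_normD _ _) _.
  have := le_trans (fst_le_enorm _) (hB x (1, 0) xr).
  have := le_trans (snd_le_enorm _) (hB x (0, 1) xr).
  by rewrite e1 e2; lra.
have lB : 0 <= `|lam| * (2 * B) by rewrite !mulr_ge0.
split.
  rewrite /tracP normrM.
  have : `|mu| * `|Defs.dcomp u p n x + Defs.dcomp u n p x| <= `|mu| * (2 * B).
    rewrite ler_wpM2l//; apply: le_trans (ler_normD _ _) _.
    by have := dc p n p1 n1; have := dc n p n1 p1; lra.
  by lra.
apply: le_trans (ler_normD _ _) _; rewrite !normrM (@ger0_norm _ 2)//.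
have := ler_wpM2l (normr_ge0 lam) dv.
have := ler_wpM2l (normr_ge0 mu) (dc n n n1 n1).
by lra.
Qed.

End C1Fields.

(** * The boundary terms *)

Section Close.
Variable R : realType.
Implicit Types B E a b : R.

(** Bounds and gap travel together because the gap of a product involves the bounds of its
    factors. *)
Definition close_within B E a a' := [/\ `|a| <= B, `|a'| <= B & `|a - a'| <= E].

Lemma closeM B1 E1 a a' B2 E2 b b' : close_within B1 E1 a a' -> close_within B2 E2 b b' ->
  close_within (B1 * B2) (B1 * E2 + B2 * E1) (a * b) (a' * b').
Proof.
move=> [a1 a2 a3] [b1 b2 b3]; split; rewrite ?normrM ?ler_pM//.
rewrite (_ : _ - _ = a * (b - b') + b' * (a - a')); last by ring.
by apply: le_trans (ler_normD _ _) _; rewrite !normrM lerD// ler_pM.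
Qed.

Lemma closeB B1 E1 a a' B2 E2 b b' : close_within B1 E1 a a' -> close_within B2 E2 b b' ->
  close_within (B1 + B2) (E1 + E2) (a - b) (a' - b').
Proof.
move=> [a1 a2 a3] [b1 b2 b3]; split.
- by apply: le_trans (ler_normB _ _) _; rewrite lerD.
- by apply: le_trans (ler_normB _ _) _; rewrite lerD.
- rewrite (_ : _ - _ = (a - a') - (b - b')); last by ring.
  by apply: le_trans (ler_normB _ _) _; rewrite lerD.
Qed.

End Close.

(** * Cubic moments and their variation with the frame *)

Section CubicMoments.
Variable R : realType.
Implicit Types (A : set (pt R)) (x z a b c n p : pt R) (d e : R).

(** With three free directions, the integrands of the boundary terms are the instances [(n, p, p)]
    and [(n, n, n)]. *)
Definition cubic d x a b c : pt R -> R := fun y => let z := vsub y x in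
  kern d (enorm z) / enorm z ^+ 2 * (dot z a * dot z b * dot z c).

Lemma measurable_cubic d x a b c :
  measurable_fun setT (cubic d x a b c : plane R -> R).
Proof.
have mdot v : measurable_fun setT ((fun y => dot (vsub y x) v) : plane R -> R).
  by apply: measurable_dot => //; exact: measurable_vsub.
apply: measurable_funM.
  apply: measurable_funM; first exact: measurable_kern.
  apply: measurable_invr_ge0 => [y|]; first exact: sqr_ge0.
  by apply: measurable_funX; exact: measurable_enorm.
by apply: measurable_funM; [apply: measurable_funM|]; exact: mdot.
Qed.

(** In terms of the unit direction [w] the radial factor becomes [K(r) * r], which is at most 1. At
    [y = x] both sides vanish, as the inverse of 0 is 0. *)
Lemma cubicE d x a b c y (w := smul (enorm (vsub y x))^-1 (vsub y x)) :
  cubic d x a b c y =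
  kern d (enorm (vsub y x)) * enorm (vsub y x) * (dot w a * dot w b * dot w c).
Proof.
rewrite /cubic /w; have [->|r0] := eqVneq (enorm (vsub y x)) 0.
  by rewrite expr0n invr0 !mulr0 !mul0r.
by rewrite /dot /smul/=; field.
Qed.

(** A product of four factors bounded by 1: the radial one is unperturbed and each of the three
    directions contributes a gap [e]. *)
Lemma cubic_close d x a b c a' b' c' e y : eball x d y ->
  enorm a = 1 -> enorm b = 1 -> enorm c = 1 ->
  enorm a' = 1 -> enorm b' = 1 -> enorm c' = 1 ->
  enorm (vsub a' a) <= e -> enorm (vsub b' b) <= e -> enorm (vsub c' c) <= e ->
  close_within 1 (3 * e) (cubic d x a' b' c' y) (cubic d x a b c y).
Proof.
rewrite /eball/= => /ltW yd a1 b1 c1 a1' b1' c1' ae be ce.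
rewrite !cubicE; set r := enorm _ in yd *; set w := smul _ _.
have w1 : enorm w <= 1.
  rewrite enorm_smul ger0_norm ?invr_ge0 ?enorm_ge0//.
  by have [r0|r0] := eqVneq r 0; [rewrite -/r r0 mulr0|rewrite -/r mulVf].
have kr : close_within 1 0 (kern d r * r) (kern d r * r).
  rewrite /close_within subrr normr0 ger0_norm ?mulr_ge0 ?kern_ge0 ?enorm_ge0//.
  have : kern d r * r <= 1.
    rewrite /kern; case: ifPn => [/andP[r0 _]|_]; last by rewrite mul0r.
    by rewrite mulVf// gt_eqF.
  by [].
have dc v v' : enorm v = 1 -> enorm v' = 1 -> enorm (vsub v' v) <= e ->
    close_within 1 e (dot w v') (dot w v).
  move=> v1 v1' ve; split.
  - by apply: le_trans (dot_le_enorm _ _) _; rewrite v1' mulr1.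
  - by apply: le_trans (dot_le_enorm _ _) _; rewrite v1 mulr1.
  - rewrite (_ : _ - _ = dot w (vsub v' v)); last by rewrite /dot/=; ring.
    apply: le_trans (dot_le_enorm _ _) _.
    by rewrite -[e]mul1r ler_pM ?enorm_ge0.
have := closeM kr (closeM (closeM (dc a a' a1 a1' ae) (dc b b' b1 b1' be)) (dc c c' c1 c1' ce)).
rewrite (_ : 1 * (1 * 1 * 1) = 1 :> R); last by ring.
by rewrite (_ : 1 * (1 * 1 * _ + _) + _ = 3 * e); last by ring.
Qed.

Definition cubic_moment A d x a b c : R := sint A (cubic d x a b c).

Lemma cubic_moment_close A d x a b c a' b' c' e : 0 <= d ->
  measurable (A : set (plane R)) -> A `<=` eball x d ->
  enorm a = 1 -> enorm b = 1 -> enorm c = 1 ->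
  enorm a' = 1 -> enorm b' = 1 -> enorm c' = 1 ->
  enorm (vsub a' a) <= e -> enorm (vsub b' b) <= e -> enorm (vsub c' c) <= e ->
  close_within (4 * d ^+ 2) (3 * e * (4 * d ^+ 2))
    (cubic_moment A d x a' b' c') (cubic_moment A d x a b c).
Proof.
move=> d0 mA Ax a1 b1 c1 a1' b1' c1' ae be ce.
have e0 : 0 <= e by exact: le_trans (enorm_ge0 _) ae.
have cl y (Ay : A y) := cubic_close (Ax _ Ay) a1 b1 c1 a1' b1' c1' ae be ce.
have m' := measurable_cubic d x a' b' c'; have m := measurable_cubic d x a b c.
split.
- by rewrite -[leRHS]mul1r; apply: (sint_le d0 ler01 mA Ax m') => y /cl[].
- by rewrite -[leRHS]mul1r; apply: (sint_le d0 ler01 mA Ax m) => y /cl[].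
- apply: (sintB_le (B := 1) d0 _ mA Ax m' m); first by rewrite mulr_ge0.
  + by move=> y /cl[].
  + by move=> y /cl[].
  + by move=> y /cl[].
Qed.

Lemma integrable_cubic A d x a b c : 0 <= d ->
  measurable (A : set (plane R)) -> A `<=` eball x d ->
  enorm a = 1 -> enorm b = 1 -> enorm c = 1 ->
  (@leb2 R).-integrable A (EFin \o cubic d x a b c).
Proof.
move=> d0 mA Ax a1 b1 c1.
apply: (integrable_sub_eball (C := 1) d0 mA Ax (measurable_cubic d x a b c)) => y Ay.
(* With zero perturbation, [cubic_close] yields the bound 1. *)
have v0 (v : pt R) : enorm (vsub v v) <= 0.
  by rewrite /enorm /vsub /dot/= !subrr !mulr0 addr0 sqrtr0.
by case: (cubic_close (Ax _ Ay) a1 b1 c1 a1 b1 c1 (v0 _) (v0 _) (v0 _)).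
Qed.

Lemma componentD i a b : component i (vadd a b) = component i a + component i b.
Proof. by case: i. Qed.

Lemma componentB i a b : component i (vsub a b) = component i a - component i b.
Proof. by case: i. Qed.

Lemma componentZ i (t : R) a : component i (smul t a) = t * component i a.
Proof. by case: i. Qed.

Lemma component_vint i A (F : pt R -> pt R) :
  component i (vint A F) = sint A (fun y => component i (F y)).
Proof. by case: i. Qed.

(** The part of component [i] of [L u - f] that depends on the frame and the tractions, with
    constants taken out of the integrals. *)
Definition boundary_stress (O GN : set (pt R)) (u : pt R -> pt R) (lam mu d : R) x
    n p (Tp Tn : R) (i : bool) : R :=
  let m := mdelta d in
  let th := theta O GN u d x in
  let J1 := cubic_moment (eball x d `\` O) d x n p p in
  let J2 := cubic_moment (eball x d `\` O) d x n n n in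
  Cbeta R * th / (2 * m) *
    (lam * component i n * J2 - (lam + 2 * mu) * component i n * J1)
  - Cbeta R / m * (Tp * component i p * J1)
  - Cbeta R / (2 * m) * (Tn * component i n * (J2 - J1)).

Lemma component_LNd_fNd (O GN : set (pt R)) (u f : pt R -> pt R) (lam mu d : R) x
    n p n' p' (Tp Tn Tp' Tn' : R) i :
  open O -> 0 <= d -> enorm n = 1 -> enorm p = 1 -> enorm n' = 1 -> enorm p' = 1 ->
  component i (vadd
    (vsub (LNd O GN u lam mu d n' p' x) (fNd O f d n' p' Tp' Tn' x))
    (vsub (fNd O f d n p Tp Tn x) (LNd O GN u lam mu d n p x))) =
  boundary_stress O GN u lam mu d x n' p' Tp' Tn' i -
  boundary_stress O GN u lam mu d x n p Tp Tn i.
Proof.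
move=> oO d0 n1 p1 n1' p1'; rewrite /boundary_stress.
set A := eball x d `\` O.
have mA : measurable (A : set (plane R)).
  by apply: measurableD; [exact: measurable_eball|exact: open_measurable_prod].
have Ax : A `<=` eball x d by move=> y [].
have icub := integrable_cubic d0 mA Ax.
have scale (F : pt R -> pt R) (G : pt R -> R) t : (@leb2 R).-integrable A (EFin \o G) ->
    (forall y, component i (F y) = t * G y) -> component i (vint A F) = t * sint A G.
  move=> iG FG; rewrite component_vint /sint -RintegralZl//.
  by apply: eq_Rintegral => y _; exact: FG.
pose z y := vsub y x; pose K y := kern d (enorm (z y)).
have E1 (a b : pt R) (k : R) : enorm a = 1 -> enorm b = 1 ->
    component i (vint A (fun y => smul (k * K y * (dot (z y) a * dot (z y) b ^+ 2) /
      enorm (z y) ^+ 2) a)) = k * component i a * cubic_moment A d x a b b.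
  move=> a1 b1; apply: scale; first exact: icub.
  by move=> y; rewrite componentZ /cubic /K /=; ring.
have E2 (a : pt R) (k : R) : enorm a = 1 ->
    component i (vint A (fun y => smul (k * K y * dot (z y) a ^+ 3 / enorm (z y) ^+ 2) a)) =
    k * component i a * cubic_moment A d x a a a.
  move=> a1; apply: scale; first exact: icub.
  by move=> y; rewrite componentZ /cubic /K /=; ring.
have E3 (a b : pt R) (k : R) : enorm a = 1 -> enorm b = 1 ->
    component i (vint A (fun y => smul (K y * (dot (z y) a * dot (z y) b ^+ 2) /
      enorm (z y) ^+ 2 * k) b)) = k * component i b * cubic_moment A d x a b b.
  move=> a1 b1; apply: scale; first exact: icub.
  by move=> y; rewrite componentZ /cubic /K /=; ring.
have E4 (a b : pt R) (k : R) : enorm a = 1 -> enorm b = 1 ->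
    component i (vint A (fun y => smul (K y *
      (dot (z y) a * (dot (z y) a ^+ 2 - dot (z y) b ^+ 2)) /
      enorm (z y) ^+ 2 * k) a)) =
    k * component i a * (cubic_moment A d x a a a - cubic_moment A d x a b b).
  move=> a1 b1; rewrite /cubic_moment /sint -RintegralB//; try exact: icub.
  apply: scale.
    by have := integrableB mA (icub a a a a1 a1 a1) (icub a b b a1 b1 b1); rewrite /comp.
  by move=> y; rewrite componentZ /cubic /K /=; ring.
pose m := mdelta d; pose th := theta O GN u d x.
(* [L] stands for the first three terms of [LNd], which do not involve the frame; unification
   supplies it. *)
have [L LE] : exists L, forall a b, enorm a = 1 -> enorm b = 1 ->
    component i (LNd O GN u lam mu d a b x) = L +
      - (Cbeta R * th / (2 * m)) * ((lam + 2 * mu) * component i a * cubic_moment A d x a b b) +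
      Cbeta R * th / (2 * m) * (lam * component i a * cubic_moment A d x a a a).
  eexists => a b a1 b1; rewrite -(E1 _ _ _ a1 b1) -(E2 _ _ a1).
  rewrite /LNd !(componentD, componentZ) !addrA; reflexivity.
have FE a b (S T : R) : enorm a = 1 -> enorm b = 1 ->
    component i (fNd O f d a b S T x) = component i (f x) +
      (Cbeta R / m * (S * component i b * cubic_moment A d x a b b) +
      Cbeta R / (2 * m) *
       (T * component i a * (cubic_moment A d x a a a - cubic_moment A d x a b b))).
  move=> a1 b1; rewrite -(E3 _ _ _ a1 b1) -(E4 _ _ _ a1 b1).
  by rewrite /fNd !(componentD, componentZ).
rewrite componentD !componentB !LE// !FE// /m /th; ring.
Qed.

(** Put [s = 4 * d ^+ 2]. A normal component times a moment varies by [4 * e * s], the [Tp] product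
    by [(4 * T + 1) * e * s], the [Tn] product by [(8 * T + 2) * e * s]. Their weights 8, 16 and 8
    come from [Cbeta = 16] and give the constant. *)
Lemma boundary_stress_le (O GN : set (pt R)) (u : pt R -> pt R) (lam mu d : R) x
    n p n' p' (Tp Tn Tp' Tn' e T B : R) i :
  open O -> 0 < d -> 0 <= e -> 0 < lam -> 0 < mu ->
  enorm n = 1 -> enorm p = 1 -> enorm n' = 1 -> enorm p' = 1 ->
  enorm (vsub n' n) <= e -> enorm (vsub p' p) <= e ->
  close_within T e Tp' Tp -> close_within T e Tn' Tn -> `|theta O GN u d x| <= B ->
  `|boundary_stress O GN u lam mu d x n' p' Tp' Tn' i -
    boundary_stress O GN u lam mu d x n p Tp Tn i| <=
  (64 * (lam + mu) * B + 128 * T + 32) * (e * (4 * d ^+ 2) / mdelta d).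
Proof.
move=> oO d0 e0 lam0 mu0 n1 p1 n1' p1' ne pe Tpe Tne thB.
set A := eball x d `\` O.
have mA : measurable (A : set (plane R)).
  by apply: measurableD; [exact: measurable_eball|exact: open_measurable_prod].
have Ax : A `<=` eball x d by move=> y [].
have m0 : 0 < mdelta d.
  have /andP[+ _] := mdelta_bounds d0; apply: lt_le_trans.
  by rewrite divr_gt0 ?exprn_gt0.
have comp_close v v' : enorm v = 1 -> enorm v' = 1 -> enorm (vsub v' v) <= e ->
    close_within 1 e (component i v') (component i v).
  move=> v1 v1' ve; split; rewrite -?componentB.
  - by rewrite -v1' component_le.
  - by rewrite -v1 component_le.
  - exact: le_trans (component_le _ _) ve.
have J1 := cubic_moment_close (ltW d0) mA Ax n1 p1 p1 n1' p1' p1' ne pe pe.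
have J2 := cubic_moment_close (ltW d0) mA Ax n1 n1 n1 n1' n1' n1' ne ne ne.
have cn := comp_close _ _ n1 n1' ne.
have cp := comp_close _ _ p1 p1' pe.
set s := 4 * d ^+ 2 in J1 J2 *.
have [_ _ h1] := closeM cn J1.
have [_ _ h2] := closeM cn J2.
have [_ _ h3] := closeM (closeM Tpe cp) J1.
have [_ _ h4] := closeM (closeM Tne cn) (closeB J2 J1).
rewrite /boundary_stress -/A.
move: h1 h2 h3 h4; set K1' := cubic_moment _ _ _ n' p' p'.
set K2' := cubic_moment _ _ _ n' n' n'; set K1 := cubic_moment _ _ _ n p p.
set K2 := cubic_moment _ _ _ n n n; set m := mdelta d in m0 *.
set th := theta _ _ _ _ _ in thB *.
set c1' := component i n'; set c1 := component i n.
set c2' := component i p'; set c2 := component i p.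
move=> h1 h2 h3 h4.
rewrite (_ : _ - _ = m^-1 * (8 * (th * (lam * (c1' * K2' - c1 * K2)
   - (lam + 2 * mu) * (c1' * K1' - c1 * K1)))
   - 16 * (Tp' * c2' * K1' - Tp * c2 * K1)
   - 8 * (Tn' * c1' * (K2' - K1') - Tn * c1 * (K2 - K1)))); last first.
  by rewrite /Cbeta; field; rewrite gt_eqF.
rewrite [leRHS]mulrA [leRHS]mulrC normrM ger0_norm ?invr_ge0 ?(ltW m0)//.
apply: ler_wpM2l; first by rewrite invr_ge0 ltW.
have es0 : 0 <= e * s by rewrite mulr_ge0// /s mulr_ge0// sqr_ge0.
set D2 := c1' * K2' - _ in h2 *; set D1 := c1' * K1' - _ in h1 *.
set D3 := Tp' * c2' * K1' - _ in h3 *; set D4 := _ - Tn * c1 * _ in h4 *.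
have t1 : `|th * (lam * D2 - (lam + 2 * mu) * D1)| <= B * (8 * (lam + mu) * (e * s)).
  rewrite normrM; apply: ler_pM => //.
  apply: le_trans (ler_normB _ _) _; rewrite !normrM (gtr0_norm lam0) (@gtr0_norm _ (lam + 2 * mu)); last lra.
  have := ler_wpM2l (ltW lam0) h2.
  have := ler_wpM2l (ltac:(lra) : 0 <= lam + 2 * mu) h1.
  by nra.
apply: le_trans (ler_normB _ _) _; rewrite normrM (@ger0_norm _ 8)//.
apply: le_trans (lerD (ler_normB _ _) (lexx _)) _.
rewrite !normrM !(@ger0_norm _ 8)// (@ger0_norm _ 16)// -normrM.
by move: t1 h3 h4; lra.
Qed.

End CubicMoments.

Lemma outward_unit_normal_enorm (R : realType) (O : set (pt R)) (b v : pt R) :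
  outward_unit_normal O b v -> enorm v = 1.
Proof.
move=> [r [e1 [e2 [g [_ [[_ [[e11 [e22 e12]] _]] ->]]]]]].
set k := derive1 g 0.
have k0 : 0 < 1 + k ^+ 2 by have := sqr_ge0 k; lra.
rewrite enorm_smul /enorm (_ : dot _ _ = 1 + k ^+ 2).
  by rewrite ger0_norm ?invr_ge0 ?sqrtr_ge0// mulVf// gt_eqF// sqrtr_gt0.
rewrite (_ : dot _ _ = dot e2 e2 - 2 * k * dot e1 e2 + k ^+ 2 * dot e1 e1).
  by rewrite e11 e22 e12; ring.
by rewrite /dot/=; ring.
Qed.

(** * Assembly of the uniform estimate *)

Unset Implicit Arguments.
Theorem theorem6 (R : realType) (O GN : set (pt R)) (u f : pt R -> pt R)
  (lam mu M : R) (xbar nrm tng : pt R -> pt R)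
  (nh ph : R -> pt R -> pt R) (Tph Tnh : R -> pt R -> R) :
  is_domain O -> bounded_set O -> C3_boundary O ->
  GN `<=` bdry O ->
  C1field u ->
  0 < lam -> 0 < mu -> 0 < M ->
  (forall b, GN b -> outward_unit_normal O b (nrm b)) ->
  (forall b, GN b -> enorm (tng b) = 1 /\ dot (tng b) (nrm b) = 0) ->
  (forall x, O x -> GN (xbar x) /\
     forall b, GN b -> enorm (vsub x (xbar x)) <= enorm (vsub x b)) ->
  (exists C0 h1 : R, 0 < h1 /\ forall h : R, 0 < h -> h < h1 ->
     forall x, intN O GN (M * h) x ->
       orthonormal2 (nh h x) (ph h x) /\
       enorm (vsub (nh h x) (nrm (xbar x))) <= C0 * h /\
       enorm (vsub (ph h x) (tng (xbar x))) <= C0 * h /\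
       `|Tph h x - tracP u mu (nrm (xbar x)) (tng (xbar x)) x| <= C0 * h /\
       `|Tnh h x - tracN u lam mu (nrm (xbar x)) x| <= C0 * h) ->
  exists C h0 : R, 0 < h0 /\ forall h : R, 0 < h -> h < h0 ->
    forall x, intN O GN (M * h) x ->
      let delta := M * h in
      let n := nrm (xbar x) in let p := tng (xbar x) in
      enorm (vadd
        (vsub (LNd O GN u lam mu delta (nh h x) (ph h x) x)
              (fNd O f delta (nh h x) (ph h x) (Tph h x) (Tnh h x) x))
        (vsub (fNd O f delta n p (tracP u mu n p x) (tracN u lam mu n x) x)
              (LNd O GN u lam mu delta n p x))) <= C.
Proof.
move=> [oO _] bO C3O GNO uC1 lam0 mu0 M0 nrmP tngP xbarP [C0 [h1 [h10 hyp]]].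
have [r Or] := bounded_sub_square bO.
have [c c0 sq] := uniform_inner_square oO bO C3O.
have [L L0 uL] := C1field_lipschitz r uC1.
have [B B0 tB] := trac_bounded lam mu r uC1.
(* Only [theta] at [x] itself multiplies the boundary terms, and [x] lies in the layer, where the
   corrected formula applies. *)
have [Th Th0 thB] : exists2 Th, 0 <= Th & forall d x, 0 < d -> d < c ->
    intN O GN d x -> `|theta O GN u d x| <= Th.
  exists (2 ^+ 20 * L / (c ^+ 4 / 32) ^+ 2) => [|d x d0 dc xN].
    apply: divr_ge0; last exact: sqr_ge0.
    by apply: mulr_ge0 => //; apply: exprn_ge0; exact: ler0n.
  rewrite /theta asboolT//; have [Ox [b [GNb xb]]] := xN.
  have [q qA] := sq x b Ox (GNO _ GNb) d d0 dc xb.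
  apply: theta_corr_le c0 d0 L0 oO (C1field_continuous uC1) qA _ => y [_ Oy].
  by apply: uL; exact: Or.
(* Bounds the exact tractions and, once [h < 1], the perturbed ones. *)
pose T := B + `|C0|.
pose K := 64 * (lam + mu) * Th + 128 * T + 32.
have T0 : 0 <= T by exact: addr_ge0.
have close_of e t t' : 0 <= e -> e <= `|C0| -> `|t| <= B -> `|t' - t| <= e ->
    close_within T e t' t.
  move=> e0 eC0 tb tt; split=> //; rewrite /T.
  - rewrite (_ : t' = t + (t' - t)); last by ring.
    by apply: le_trans (ler_normD _ _) _; lra.
  - by have := normr_ge0 C0; lra.
have K0 : 0 <= K.
  have : 0 <= (lam + mu) * Th by apply: mulr_ge0 => //; lra.
  by rewrite /K; lra.
(* The factor 2 counts the components. The threshold 1 gives [e <= |C0|], and [c / M] gives [d < c];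
   the absolute value is taken because [C0] may be negative. *)
exists (2 * (K * (256 * `|C0| / M))), (Num.min h1 (Num.min 1 (c / M))); split.
  by rewrite !lt_min h10 ltr01 divr_gt0.
move=> h h0; rewrite !lt_min => /and3P[hh1 h1' hc] x xN; cbv zeta.
set d := M * h; set n := nrm (xbar x); set p := tng (xbar x).
have [Ox _] := xN.
have [on [nn [pp [Tpp Tnn]]]] := hyp h h0 hh1 x xN.
have d0 : 0 < d by exact: mulr_gt0.
have dc : d < c by rewrite /d mulrC -ltr_pdivlMr.
have GNx : GN (xbar x) by case: (xbarP x Ox).
have n1 : enorm n = 1 by exact: outward_unit_normal_enorm (nrmP _ GNx).
have p1 : enorm p = 1 by case: (tngP _ GNx).
have n1' : enorm (nh h x) = 1 by case: on => + _; rewrite /enorm => ->; rewrite sqrtr1.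
have p1' : enorm (ph h x) = 1 by case: on => _ [+ _]; rewrite /enorm => ->; rewrite sqrtr1.
pose e := `|C0| * h.
have e0 : 0 <= e by rewrite mulr_ge0// ltW.
have C0e : C0 * h <= e by rewrite ler_wpM2r ?ler_norm// ltW.
have eC0 : e <= `|C0| by rewrite ler_piMr// ltW.
have [tP tN] := tB x n p (Or _ Ox) n1 p1.
have diff i := boundary_stress_le i oO d0 e0 lam0 mu0 n1 p1 n1' p1'
  (le_trans nn C0e) (le_trans pp C0e) 
  (close_of _ _ _ e0 eC0 tP (le_trans Tpp C0e)) (close_of _ _ _ e0 eC0 tN (le_trans Tnn C0e)) (thB _ _ d0 dc xN).
(* M-convergence enters here: [mdelta d >= d ^+ 3 / 64] leaves [256 * |C0| * h / d], and
   [d = M * h]. *)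
have scale_le : e * (4 * d ^+ 2) / mdelta d <= 256 * `|C0| / M.
  have /andP[m1 _] := mdelta_bounds d0.
  have m0 : 0 < mdelta d by apply: lt_le_trans m1; rewrite divr_gt0 ?exprn_gt0.
  rewrite ler_pdivrMr//.
  rewrite (_ : e * _ = 256 * `|C0| / M * (d ^+ 3 / 64)); last first.
    by rewrite /e /d; field; rewrite gt_eqF.
  by apply: ler_wpM2l m1; rewrite divr_ge0 ?mulr_ge0// ltW.
set v := vadd _ _.
have vi i : `|component i v| <= K * (256 * `|C0| / M).
  rewrite /v component_LNd_fNd ?(ltW d0)//.
  by apply: le_trans (diff i) _; exact: ler_wpM2l.
apply: le_trans (enorm_le_l1 _) _.
by rewrite mulr2n mulrDl mul1r; apply: lerD; [exact: vi true|exact: vi false].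
Qed.
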